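(* Let $c, m, n$ be nonnegative integers with $c\ge 1$ odd and $2\le m\le n$. Then $$\nu_2\big(S(c2^{n+1},2^m-1)-S(c2^n, 2^m-1)\big)=n+1,$$ except when $n=m=2$ and $c=1$, in which case $\nu_2\big(S(8,3)-S(4,3)\big)=6$.
   Context: $S(n,k)$ denotes the Stirling number of the second kind (the number of partitions of an $n$-element set into exactly $k$ nonempty blocks). For a nonzero integer $m$, $\nu_2(m)$ denotes the 2-adic valuation of $m$. *)

(* Defs.v *)
From mathcomp Require Import all_boot all_order all_algebra.

Set Implicit Arguments.
Unset Strict Implicit.
Unset Printing Implicit Defensive.

(* MathComp's [partition] already requires set0 \notin P, so all blocks are
   nonempty. *)
Definition stirling2 (n k : nat) : nat :=
  #|[set P : {set {set 'I_n}} | partition P [set: 'I_n] && (#|P| == k)]|.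

(* Meaningful for nonzero z only; nu2 0 = 0 since logn 2 0 = 0, so that
   nu2 z = e with e > 0 forces z to be nonzero. *)
Definition nu2 (z : int) : nat := logn 2 `|z|%N.

(* Main.v *)
Require Import Defs.
From mathcomp Require Import all_boot all_order all_algebra.
From mathcomp Require Import zify ring.

(** Let k = 2^m - 1 and N = c 2^n.  Inclusion-exclusion gives
    k! S(N,k) = Odd(N) - Ev(N), where Odd(N) and Ev(N) sum C(k,x) x^N over the
    odd and the even x <= k; Ev(N) is negligible because 2^N divides it, and for
    m >= 3 even 2^(N+1) does (for m = 2, n = 2, c = 1 it is not negligible,
    whence the exception).  Expand (2j+1)^N = sum_r b_r(N) 2^r j^_r.  Then
    Odd(N) = sum_r b_r(N) w_r, where w_r = sum_j C(k,2j+1) 2^r j^_r satisfies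
    2^r w_r = 2^(k-1) (k-1-r)^_r, so that v(w_r) = k - 1 - v(r+1).
    Modulo 2^n, b_r(N) is C(N,r); moreover 2^(n+1) divides b_r(N) for odd r, and
    2^(n+2) does for r = 3 mod 4.  Since v(k!) = k - m, for m >= 3 the only term
    with r > 0 that matters modulo 2^(n+2) k! is r = 2^(m-2), of valuation
    exactly n + 1 + v(k!).  As w_0 does not depend on N, comparing n with n+1
    gives the result.  The case m = 2 is 6 S(N,3) = 3^N - 3 2^N + 3. *)

Import GRing.Theory.

(** * Stirling numbers of the second kind *)

Lemma sum_double (f : nat -> int) M :
  (\sum_(0 <= x < M.*2) f x
   = \sum_(0 <= j < M) f j.*2 + \sum_(0 <= j < M) f j.*2.+1)%R.
Proof.
elim: M => [|M IH]; first by rewrite !big_nil.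
by rewrite doubleS !big_nat_recr //= IH; ring.
Qed.

Lemma sum_nat_tail0 (F : nat -> nat) n p : n <= p ->
  (forall i, n <= i -> F i = 0) -> \sum_(0 <= i < p) F i = \sum_(0 <= i < n) F i.
Proof.
move=> lenp F0; rewrite (big_cat_nat (n := n)) //= [X in _ + X]big_nat_cond.
by rewrite [X in _ + X]big1 ?addn0 // => i /andP[/andP[/F0]].
Qed.

Section KernelCount.
Variables (n x : nat) (P : {set {set 'I_n}}).
Hypothesis partP : partition P [set: 'I_n].

Let covP (i : 'I_n) : i \in cover P.
Proof. by rewrite (cover_partition partP) in_setT. Qed.

Let block (i : 'I_n) : {B : {set 'I_n} | B \in P} :=
  exist _ (pblock P i) (pblock_mem (covP i)).

(** Functions with kernel [P] are the injective colourings of its blocks: [Phi] precomposes an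
    injection with [block]. *)
Lemma card_preim_partition :
  #|[set f : {ffun 'I_n -> 'I_x} | preim_partition f [set: 'I_n] == P]|
  = x ^_ #|P|.
Proof.
have trP := partition_trivIset partP.
have ex (B : {B | B \in P}) : exists i, i \in val B.
  case: B => B BP /=; apply/set0Pn; apply: contraTneq BP => ->.
  by case/and3P: partP.
pose rep B := xchoose (ex B).
have repE B : pblock P (rep B) = val B.
  by apply: def_pblock => //; [exact: valP | exact: (xchooseP (ex B))].
pose Phi (g : {ffun {B | B \in P} -> 'I_x}) := [ffun i => g (block i)].
have blockrep B : block (rep B) = B by apply: val_inj; rewrite /= repE.
have PhiI : injective Phi.
  move=> g h /ffunP E; apply/ffunP => B.
  by have := E (rep B); rewrite !ffunE blockrep.
have -> : x ^_ #|P| = #|[set g : {ffun {B | B \in P} -> 'I_x} | injectiveb g]|.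
  by rewrite card_inj_ffuns card_ord card_sig; congr (_ ^_ _); apply: eq_card.
rewrite -(card_imset _ PhiI); apply: eq_card => f; rewrite inE.
have preimE (i j : 'I_n) :
    (j \in pblock (preim_partition f [set: 'I_n]) i) = (f i == f j).
  rewrite /preim_partition pblock_equivalence_partition ?inE //.
  by split=> // /eqP->.
apply/eqP/imsetP => [E|[g]].
  rewrite E in preimE.
  have same (i j : 'I_n) : (pblock P i == pblock P j) = (f i == f j).
    by rewrite eq_pblock // preimE.
  exists [ffun B => f (rep B)].
    rewrite inE; apply/injectiveP => B C; rewrite !ffunE => /eqP.
    by rewrite -same !repE => /eqP; apply: val_inj.
  by apply/ffunP => i; rewrite !ffunE; apply/eqP; rewrite -same repE.
rewrite inE => /injectiveP gI ->.
rewrite -[RHS](preim_partition_pblock partP).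
rewrite /preim_partition /equivalence_partition.
apply: eq_in_imset => i _; apply: eq_finset => j.
rewrite !ffunE (inj_eq gI) in_setT /=.
by apply/eqP/eqP => [/(congr1 val)|] //= E; apply: val_inj.
Qed.

End KernelCount.

(* Sort the functions from 'I_n to 'I_x by their kernel partition. *)
Lemma expn_sum_stirling2 x n :
  x ^ n = \sum_(0 <= j < n.+1) stirling2 n j * x ^_ j.
Proof.
have -> : x ^ n = \sum_(f : {ffun 'I_n -> 'I_x}) 1.
  by rewrite sum1_card card_ffun !card_ord.
rewrite (partition_big (fun f : {ffun 'I_n -> 'I_x} =>
   preim_partition f [set: 'I_n]) (fun P => partition P [set: 'I_n])) /=;
  last by move=> f _; exact: preim_partitionP.
have le_card (P : {set {set 'I_n}}) : partition P [set: 'I_n] -> #|P| < n.+1.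
  move=> partP; have trP := partition_trivIset partP.
  have := card_partition partP; rewrite cardsT card_ord ltnS => E.
  rewrite [leqRHS]E -sum1_card; apply: leq_sum => B BP; rewrite card_gt0.
  by apply: contraTneq BP => ->; case/and3P: partP.
rewrite (eq_bigr (fun P : {set {set 'I_n}} => x ^_ #|P|)); last first.
  by move=> P partP; rewrite sum1dep_card card_preim_partition.
(* Group by the number of blocks; [inord] is faithful by [le_card]. *)
rewrite (partition_big (fun P : {set {set 'I_n}} => inord #|P| : 'I_n.+1) xpredT) //=.
rewrite big_mkord; apply: eq_bigr => j _.
rewrite /stirling2 -sum1dep_card big_distrl /=.
apply: eq_big => [P|P /andP[partP /eqP <-]].
  case partP: (partition P _) => //=.
  by rewrite -val_eqE /= inordK ?le_card.
by rewrite mul1n inordK ?le_card.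
Qed.

Fixpoint stirl (n k : nat) : nat :=
  match n, k with
  | 0, 0 => 1
  | n'.+1, k'.+1 => k'.+1 * stirl n' k'.+1 + stirl n' k'
  | _, _ => 0
  end.

Lemma stirl_small n k : n < k -> stirl n k = 0.
Proof.
elim: n k => [|n IH] [|k] //= ltnk.
by rewrite (IH k) // (IH k.+1) ?muln0 // ltnW.
Qed.

Lemma stirlnn n : stirl n n = 1.
Proof. by elim: n => //= n ->; rewrite stirl_small ?muln0. Qed.

(** Since x x^_j = x^_(j+1) + j x^_j, multiplication by x reproduces the recurrence of [stirl]. *)
Lemma expn_sum_stirl x n :
  x ^ n = \sum_(0 <= j < n.+1) stirl n j * x ^_ j.
Proof.
elim: n => [|n IH]; first by rewrite big_nat1.
rewrite big_nat_recl //= mul0n add0n.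
under eq_bigr do rewrite mulnDl.
rewrite big_split /= expnSr IH big_distrl /=.
pose G j := j * stirl n j * x ^_ j.
have -> : \sum_(0 <= i < n.+1) i.+1 * stirl n i.+1 * x ^_ i.+1
    = \sum_(0 <= i < n.+1) G i.
  by rewrite [RHS]big_nat_recl // [LHS]big_nat_recr //= stirl_small // muln0 /G !mul0n addn0 add0n.
rewrite -big_split /=; apply: eq_bigr => j _; rewrite /G ffactnSr.
have [ltxj|lejx] := ltnP x j; first by rewrite ffact_small //; lia.
by rewrite -[X in _ * X = _](subnKC lejx); ring.
Qed.

(** Evaluation at x = j gives a triangular system with diagonal entries j!. *)
Lemma ffact_coef_unique n (a b : nat -> nat) :
  (forall x, \sum_(0 <= j < n) a j * x ^_ j = \sum_(0 <= j < n) b j * x ^_ j) ->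
  forall j, j < n -> a j = b j.
Proof.
move=> E j; elim/ltn_ind: j => j IH ltjn.
have cut (c : nat -> nat) : \sum_(0 <= i < n) c i * j ^_ i
    = \sum_(0 <= i < j) c i * j ^_ i + c j * j`!.
  have tail0 : \sum_(j.+1 <= i < n) c i * j ^_ i = 0.
    rewrite big_nat_cond big1 // => i /andP[/andP[ltji _] _].
    by rewrite ffact_small ?muln0.
  by rewrite (big_cat_nat (n := j.+1)) //= big_nat_recr //= ffactnn tail0 addn0.
have := E j; rewrite !cut.
rewrite (@eq_big_nat _ _ _ 0 j _ (fun i => b i * j ^_ i)); last first.
  by move=> i /andP[_ ltij]; rewrite IH // (ltn_trans ltij).
by move/addnI/eqP; rewrite eqn_pmul2r ?fact_gt0 // => /eqP.
Qed.

Lemma stirling2E n k : k <= n -> stirling2 n k = stirl n k.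
Proof.
rewrite -ltnS; apply: ffact_coef_unique => x.
by rewrite -expn_sum_stirl -expn_sum_stirling2.
Qed.

(** A k-th finite difference at 0. Absorption x C(k+1, x) = (k+1) C(k, x-1) lowers k and i together;
    for i = 0 and positive k the sum is (1-1)^k = 0. *)
Lemma altsum_bin_ffact k i :
  (\sum_(0 <= x < k.+1) (-1) ^+ x * ('C(k, x) * x ^_ i)%:Z
   = if i == k then (-1) ^+ k * k`!%:Z else 0)%R.
Proof.
elim: k i => [|k IH] [|i].
- by rewrite big_nat1.
- by rewrite big_nat1 ffact_small.
- under eq_bigr do rewrite ffactn0 muln1.
  have /= := @exprDn int 1%R (-1)%R k.+1; rewrite subrr expr0n /=.
  rewrite big_mkord => E; apply: etrans (esym E); apply: eq_bigr => x _.
  by rewrite expr1n mul1r -mulr_natr natz.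
rewrite big_nat_recl // ffact_small // muln0 mulr0 add0r eqSS.
under eq_bigr => x _.
  rewrite ffactSS mulnA (mulnC 'C(_, _)) -mul_bin_diag -mulnA PoszM exprS.
  rewrite (_ : _ * _ = - k.+1%:Z * ((-1) ^+ x * ('C(k, x) * x ^_ i)%:Z))%R; last by rewrite -pred_Sn; ring.
  over.
rewrite -big_distrr /= IH.
by case: eqP => // _; rewrite ?mulr0 // factS PoszM exprS; ring.
Qed.

(** Inclusion-exclusion: after expanding x^N in falling factorials, only index k survives
    [altsum_bin_ffact]. The even terms stand on the left to stay within [nat]. *)
Lemma fact_stirl_altsum M N k : k = M.*2.+1 ->
  k`! * stirl N k + \sum_(0 <= j < M.+1) 'C(k, j.*2) * j.*2 ^ N
  = \sum_(0 <= j < M.+1) 'C(k, j.*2.+1) * j.*2.+1 ^ N.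
Proof.
move=> kE; have E : (\sum_(0 <= x < M.+1.*2) (-1) ^+ x * ('C(k, x) * x ^ N)%:Z
          = - (k`! * stirl N k)%:Z)%R.
  under eq_bigr => x _.
    rewrite expn_sum_stirl big_distrr /= (big_morph Posz PoszD (erefl _)) big_distrr /=.
    under eq_bigr => j _.
      rewrite mulnCA PoszM mulrCA; over.
    over.
  rewrite exchange_big_nat /=.
  under eq_bigr => j _.
    rewrite -big_distrr /= doubleS -kE altsum_bin_ffact; over.
  have [ltNk|lekN] := ltnP N k.
    rewrite stirl_small // muln0 oppr0 big_nat_cond big1 // => j.
    rewrite ltnS => /andP[/andP[_ lejN] _].
    by rewrite ltn_eqF ?mulr0 // (leq_ltn_trans lejN).
  rewrite big_mkord (bigD1 (inord k : 'I_N.+1)) //= inordK // eqxx.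
  rewrite big1 => [|j]; last first.
    by rewrite -val_eqE /= inordK // => /negPf->; rewrite mulr0.
  rewrite addr0 -signr_odd (_ : odd k) ?kE /= ?odd_double // PoszM; ring.
have := E; rewrite sum_double /=.
under eq_bigr do rewrite -signr_odd odd_double mul1r.
under [X in (_ + X)%R]eq_bigr do rewrite -signr_odd /= odd_double mulN1r.
rewrite sumrN -!(big_morph Posz PoszD (erefl _)); lia.
Qed.

(** * Binomial sums over odd indices *)

Lemma oddbin_double b n r :
  \sum_(0 <= j < b) 'C(n.+1, j.*2.+1) * 'C(j, r)
  = \sum_(0 <= j < b) 'C(n, j.*2.+1) * 'C(j, r)
    + \sum_(0 <= j < b) 'C(n, j.*2) * 'C(j, r).
Proof. by rewrite -big_split /=; apply: eq_bigr => j _; rewrite binS mulnDl. Qed.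

Lemma evenbin_double b n r : n.+1 < b.*2 ->
  \sum_(0 <= j < b) 'C(n.+1, j.*2) * 'C(j, r)
  = \sum_(0 <= j < b) 'C(n, j.*2) * 'C(j, r)
    + \sum_(0 <= j < b) 'C(n, j.*2.+1) * 'C(j.+1, r).
Proof.
case: b => // b; rewrite doubleS !ltnS => ltnb.
rewrite big_nat_recl // [X in _ = X + _]big_nat_recl //.
rewrite [X in _ = _ + X]big_nat_recr //= ['C(n, b.*2.+1)]bin_small // mul0n addn0.
rewrite -addnA -big_split /= !bin0; congr (_ + _).
by apply: eq_bigr => j _; rewrite doubleS binS mulnDl.
Qed.

(** Pascal's rule on both parities gives A(n+2, r+1) = 2 A(n+1, r+1) + A(n, r) for the sum A(n, r),
    and 2^n C(n-r, r) / 4^r obeys the same recurrence. *)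
Lemma sum_oddbin_bin b n r : n < b.*2 ->
  4 ^ r * \sum_(0 <= j < b) 'C(n.+1, j.*2.+1) * 'C(j, r) = 2 ^ n * 'C(n - r, r).
Proof.
elim/ltn_ind: n r => -[|[|n]] IH r ltnb.
- case: b ltnb {IH} => // b _; rewrite big_nat_recl // big1 ?addn0 => [|j _].
    by rewrite bin1; case: r => [|r] //; rewrite !muln0.
  by rewrite bin_small // doubleS.
- case: b ltnb {IH} => // b _; rewrite big_nat_recl // big1 ?addn0 => [|j _].
    by rewrite bin1; case: r => [|r] //; rewrite !muln0.
  by rewrite bin_small // doubleS.
have IH1 := IH n.+1 (ltnSn _) _ (ltnW ltnb).
have IH0 := IH n (ltnW (ltnSn _)) _ (ltnW (ltnW ltnb)).
rewrite oddbin_double evenbin_double ?(ltnW ltnb) //.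
case: r => [|r].
  rewrite [X in _ + (_ + X)](eq_bigr (fun j => 'C(n.+1, j.*2.+1) * 'C(j, 0)));
    last by move=> j _; rewrite !bin0.
  have := IH1 0; rewrite oddbin_double !subn0 !bin0 !mul1n !muln1 (expnS 2 n.+1).
  lia.
under [X in _ + (_ + X)]eq_bigr => j _ do rewrite (binS j) mulnDr.
rewrite big_split /= (addnA _ _ (\sum_(0 <= j < b) _ * 'C(j, r))).
rewrite [X in _ + (X + _)]addnC -oddbin_double.
have binE : 'C(n.+1 - r, r.+1) = 'C(n - r, r.+1) + 'C(n - r, r).
  have [lern|ltnr] := leqP r n; first by rewrite subSn // binS.
  by rewrite !bin_small //; lia.
have := IH1 r.+1; have := IH0 r; rewrite !subSS binE !expnS.
move: (4 ^ r) (2 ^ n) (\sum_(0 <= j < b) _) (\sum_(0 <= j < b) _) => x y s t.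
move: 'C(_, _) 'C(_, _) => p q; lia.
Qed.

(* The weight w_r of the header, with k = M.*2.-1. *)
Definition oddmoment M r := \sum_(0 <= j < M) 'C(M.*2.-1, j.*2.+1) * (2 ^ r * j ^_ r).

Lemma oddmomentE M r : 0 < M ->
  2 ^ r * oddmoment M r = 2 ^ M.-1.*2 * (M.-1.*2 - r) ^_ r.
Proof.
case: M => // M _; rewrite /oddmoment /= -bin_ffact [RHS]mulnA.
rewrite -(@sum_oddbin_bin M.+1) ?ltn_double //.
rewrite (expnMn 2 2 r) !big_distrr !big_distrl /=; apply: eq_bigr => j _.
by rewrite -bin_ffact; ring.
Qed.

Lemma oddmoment_small M r : M <= r -> oddmoment M r = 0.
Proof.
move=> leMr; rewrite /oddmoment big_nat big1 // => j /andP[_ ltjM].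
by rewrite ffact_small ?muln0 // (leq_trans ltjM).
Qed.

(** Contribution of the power j^(r+d) in (1+2j)^N to the coefficient of 2^r j^_r. *)
Definition oddterm N r d := 'C(N, r + d) * 2 ^ d * stirl (r + d) r.

(* The coefficient b_r(N) of the header. *)
Definition oddcoef N r := \sum_(0 <= d < N.+1) oddterm N r d.

Lemma expn_odd_sum N j :
  j.*2.+1 ^ N = \sum_(0 <= r < N.+1) oddcoef N r * (2 ^ r * j ^_ r).
Proof.
rewrite -addn1 expnDn -(big_mkord xpredT (fun i => 'C(N, i) * (j.*2 ^ (N - i) * 1 ^ i))).
rewrite big_nat_rev /= add0n.
transitivity (\sum_(0 <= i < N.+1) \sum_(0 <= r < N.+1)
    'C(N, i) * 2 ^ i * stirl i r * j ^_ r).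
  rewrite !big_mkord; apply: eq_bigr => i _; rewrite exp1n muln1 subSS.
  rewrite bin_sub ?subKn -1?ltnS // -mul2n expnMn mulnA.
  rewrite (@sum_nat_tail0 _ i.+1) // => [|r ltir]; last first.
    by rewrite stirl_small // muln0.
  rewrite (expn_sum_stirl j) big_distrr /=; apply: eq_bigr => r _.
  by rewrite mulnA.
rewrite exchange_big_nat /=; apply: eq_bigr => r _.
rewrite /oddcoef /oddterm big_distrl /=.
(* Padding the range of i with vanishing C(N, i) lets d = i - r run over exactly 0..N. *)
rewrite -(@sum_nat_tail0 (fun i => 'C(N, i) * 2 ^ i * stirl i r * j ^_ r) N.+1 (r + N.+1)) => [||i ltNi].
- rewrite (big_cat_nat (n := r)) ?leq_addr //= big_nat_cond big1 => [|i /andP[/andP[_ ltir] _]].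
    rewrite add0n -{1}[r]add0n big_addn addnC addnK.
    apply: eq_bigr => d _; rewrite (addnC d) expnD; ring.
  by rewrite stirl_small // muln0.
- by rewrite leq_addl.
by rewrite bin_small.
Qed.

Lemma sum_odd_expn M N : M <= N.+1 ->
  \sum_(0 <= j < M) 'C(M.*2.-1, j.*2.+1) * j.*2.+1 ^ N
  = \sum_(0 <= r < M) oddcoef N r * oddmoment M r.
Proof.
move=> leMN; rewrite -(@sum_nat_tail0 (fun r => oddcoef N r * oddmoment M r) M N.+1) => [|//|r]; last first.
  by move/oddmoment_small->; rewrite muln0.
rewrite /oddmoment.
under eq_bigr do rewrite expn_odd_sum big_distrr /=.
rewrite exchange_big_nat /=; apply: eq_bigr => r _.
by rewrite big_distrr; apply: eq_bigr => j _; rewrite mulnCA.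
Qed.

(** * Divisibility of the coefficients [oddcoef] *)

(* Partitions of q elements into q - d blocks, all of size at least 2. *)
Fixpoint assoc_stirl (d q : nat) : nat :=
  match d, q with
  | 0, 0 => 1
  | d'.+1, q'.+2 => q'.+1 * assoc_stirl d' q' + (q'.+1 - d') * assoc_stirl d' q'.+1
  | _, _ => 0
  end.

Lemma assoc_stirl_le d q : 0 < d -> q <= d -> assoc_stirl d q = 0.
Proof.
elim: d q => // -[|d] IH [|[|q]] // _ leqd.
rewrite [LHS](erefl : _ = q.+1 * assoc_stirl d.+1 q + (q.+1 - d.+1) * assoc_stirl d.+1 q.+1).
rewrite (IH q) // ?muln0 ?add0n; last exact: ltnW.
by move: leqd; rewrite !ltnS -subn_eq0 subSS => /eqP->.
Qed.

Lemma assoc_stirl_gt d q : d.*2 < q -> assoc_stirl d q = 0.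
Proof.
elim: d q => [|d IH] [|[|q]] //= ltdq.
by rewrite !IH ?muln0 //; lia.
Qed.

(* As only d < q <= 2d occur, v(C(N, r + d) S(r + d, r)) >= n - log2 (2d) whatever
   r is, which the factor 2^d of [oddterm] outweighs. *)
Lemma stirl_assoc d r Q : d.*2 < Q ->
  stirl (r + d) r = \sum_(0 <= q < Q) assoc_stirl d q * 'C(r + d, q).
Proof.
elim: d r Q => [|d IHd] r Q ltdQ.
  case: Q ltdQ => // Q _; rewrite big_nat_recl // big1 => [|[|q] _] //.
  by rewrite addn0 stirlnn bin0.
case: Q ltdQ => [|[|Q]] // ltdQ.
elim: r => [|r IHr].
  rewrite add0n [LHS]/= big_nat big1 // => q _.
  have [leqd|ltdq] := leqP q d.+1; first by rewrite assoc_stirl_le.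
  by rewrite bin_small ?muln0.
have -> : stirl (r.+1 + d.+1) r.+1 = r.+1 * stirl (r.+1 + d) r.+1 + stirl (r + d.+1) r.
  by rewrite addSn /= addnS.
rewrite IHr (IHd _ Q.+1); last lia.
rewrite -addSnnS; set x := r.+1 + d.
rewrite [RHS]big_nat_recl // [X in _ + X = _]big_nat_recl //= mul0n !add0n.
rewrite -addSnnS addSn -/x.
under [RHS]eq_bigr => q _ do rewrite (binS x) mulnDr.
rewrite big_split /= addnC; congr (_ + _).
rewrite [RHS]big_nat_recl //= !mul0n add0n.
under [RHS]eq_bigr do rewrite mulnDl.
rewrite big_split /=.
have -> : \sum_(0 <= i < Q) (i.+1 - d) * assoc_stirl d i.+1 * 'C(x, i.+1)
    = \sum_(0 <= i < Q.+1) (i - d) * assoc_stirl d i * 'C(x, i).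
  by rewrite [RHS]big_nat_recl // sub0n mul0n.
have -> : \sum_(0 <= i < Q) i.+1 * assoc_stirl d i * 'C(x, i.+1)
    = \sum_(0 <= i < Q.+1) i.+1 * assoc_stirl d i * 'C(x, i.+1).
  by rewrite [RHS]big_nat_recr //= assoc_stirl_gt ?muln0 ?addn0 //; lia.
(* Use (q+1) C(x, q+1) = (x-q) C(x, q) and (x-q) + (q-d) = r+1; where a difference truncates,
   [assoc_stirl] or the binomial is 0. *)
rewrite -big_split big_distrr /=; apply: eq_bigr => q _.
rewrite -[_ * _ * 'C(x, q.+1)]mulnAC mul_bin_left.
have [ltqd|ledq] := ltnP q d; first by rewrite assoc_stirl_le ?muln0 //; lia.
have [ltxq|leqx] := ltnP x q; first by rewrite bin_small // !muln0.
by rewrite (_ : r.+1 = (x - q) + (q - d)); [ring | move: leqx; rewrite /x; lia].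
Qed.

Lemma mul_bin_bin N i q : q <= i -> 'C(N, i) * 'C(i, q) = 'C(N, q) * 'C(N - q, i - q).
Proof.
move=> leqi; have [leiN|ltNi] := leqP i N; last first.
  rewrite (bin_small ltNi); have [ltNq|leqN] := ltnP N q; first by rewrite (bin_small ltNq).
  by rewrite (@bin_small (N - q)) ?muln0 //; lia.
have := bin_fact leiN; have := bin_fact leqi.
have := bin_fact (leq_trans leqi leiN); have := bin_fact (leq_sub2r q leiN).
rewrite (_ : N - q - (i - q) = N - i); last lia.
move=> <- <- E1 E2.
apply/eqP; rewrite -(@eqn_pmul2r (q`! * (i - q)`! * (N - i)`!)) ?muln_gt0 ?fact_gt0 //.
by apply/eqP; move: E2; rewrite -E1 => E2; rewrite -[LHS]mulnA; lia.
Qed.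

(** From q C(N, q) = N C(N-1, q-1): at most v(q) factors 2 are lost. *)
Lemma dvdn_exp_bin n N q e :
  2 ^ n %| N -> 0 < q -> logn 2 q <= e -> 2 ^ n %| 2 ^ e * 'C(N, q).
Proof.
move=> dvdN q0 leqe.
have [q' odd_q' qE] := pfactor_coprime (isT : prime 2) q0.
have : 2 ^ n %| q * 'C(N, q).
  by case: q q0 {leqe qE} => // q _; rewrite -mul_bin_diag dvdn_mulr.
rewrite {1}qE -mulnA Gauss_dvdr ?coprimeXl // => dvd.
by rewrite -(subnK leqe) expnD -mulnA dvdn_mull.
Qed.

Lemma dvdn_exp_binD a n N q e :
  2 ^ n %| N -> 0 < q -> logn 2 q <= e -> 2 ^ (a + n) %| 2 ^ (a + e) * 'C(N, q).
Proof. by move=> *; rewrite !expnD -mulnA dvdn_pmul2l ?expn_gt0 // dvdn_exp_bin. Qed.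

Lemma dvdn_bin_odd n N q : 2 ^ n %| N -> odd q -> 2 ^ n %| 'C(N, q).
Proof.
move=> dvdN oddq; rewrite -['C(N, q)]mul1n -(expn0 2) dvdn_exp_bin //; first by case: q oddq.
by rewrite leqn0 logn_coprime // coprime2n.
Qed.

(** [stirl_assoc] and [mul_bin_bin] bring out C(N, q), where q is bounded by 2d independently of
    r. *)
Lemma dvdn_oddterm D N r d : 0 < d ->
  (forall q, d < q <= d.*2 -> q <= r + d ->
     D %| 2 ^ d * ('C(N, q) * 'C(N - q, r + d - q))) ->
  D %| oddterm N r d.
Proof.
move=> d0 dvdD; rewrite /oddterm (@stirl_assoc d r d.*2.+1) // big_distrr /=.
rewrite big_nat; apply: (big_ind (fun x => D %| x)) => // [x y|q /andP[_ leqd]].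
  exact: dvdn_add.
have [leqd'|ltdq] := leqP q d; first by rewrite assoc_stirl_le ?muln0.
have [leqr|ltrq] := leqP q (r + d); last by rewrite ['C(r + d, q)]bin_small ?muln0.
rewrite mulnCA -mulnA (mulnCA 'C(_, _)) mul_bin_bin // dvdn_mull // dvdD //.
by rewrite ltdq.
Qed.

Lemma logn2_lt q e : 0 < q -> q < 2 ^ e.+1 -> logn 2 q <= e.
Proof.
move=> q0 ltq; rewrite -ltnS -(ltn_exp2l _ _ (isT : 1 < 2)).
by rewrite (leq_ltn_trans _ ltq) // dvdn_leq // pfactor_dvdnn.
Qed.

Lemma dvdn_oddterm_gen n N r d : 0 < d -> 2 ^ n %| N -> 2 ^ n %| oddterm N r d.
Proof.
move=> d0 dvdN; apply: dvdn_oddterm => // q /andP[ltdq leqd] _.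
rewrite mulnA dvdn_mulr // dvdn_exp_bin //; first exact: leq_ltn_trans _ ltdq.
apply: logn2_lt; first exact: leq_ltn_trans _ ltdq.
rewrite expnS mul2n; apply: leq_ltn_trans leqd _.
by rewrite ltn_double ltn_expl.
Qed.

(** Here q <= 2d < 2^(d-1), so v(q) <= d - 2 and two factors 2 are left over; 2d < 2^(d-1) fails at
    d = 4. *)
Lemma dvdn_oddterm_ge5 n N r d : 5 <= d -> 2 ^ n %| N -> 2 ^ n.+2 %| oddterm N r d.
Proof.
move=> d5 dvdN; apply: dvdn_oddterm => [|q /andP[ltdq leqd] _]; first lia.
rewrite -(subnKC (leq_trans (isT : 2 <= 5) d5)) mulnA dvdn_mulr //.
rewrite (@dvdn_exp_binD 2) //.
  exact: leq_ltn_trans _ ltdq.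
apply: logn2_lt; first exact: leq_ltn_trans _ ltdq.
apply: leq_ltn_trans leqd _; rewrite expnS mul2n ltn_double.
elim: d d5 {ltdq} => // d IH; rewrite leq_eqVlt => /predU1P[<- //|d5].
by have := IH d5; rewrite (_ : d.+1 - 2 = (d - 2).+1) ?expnS; lia.
Qed.

(** * Terms with d <= 4 for odd r *)

Section OddIndex.
Variables (n N r : nat).
Hypotheses (n2 : 2 <= n) (dvdN : 2 ^ n %| N) (oddr : odd r).

Let dvd4N : 4 %| N.
Proof. by apply: dvdn_trans dvdN; rewrite (dvdn_exp2l 2 n2). Qed.

Let r0 : 0 < r. Proof. by case: r oddr. Qed.

(** The sum is C(N, r) (1 + r(N-r)); 2^n divides the first factor. The second is rN - (r^2 - 1), and
    4 divides both N and r^2 - 1. *)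
Lemma dvdn_oddterm01 : 2 ^ n.+2 %| oddterm N r 0 + oddterm N r 1.
Proof.
rewrite /oddterm addn0 addn1 stirlnn !muln1 expn1.
have -> : stirl r.+1 r = 'C(r.+1, 2).
  have := @stirl_assoc 1 r 3 isT; rewrite addn1 => ->.
  rewrite !big_nat_recl // big_geq // [assoc_stirl 1 0]/= [assoc_stirl 1 1]/= [assoc_stirl 1 2]/=; lia.
have -> : 'C(N, r.+1) * 2 * 'C(r.+1, 2) = 'C(N, r) * (r * (N - r)).
  have := mul_bin_left N r; have := mul_bin_diag r.+1 1; rewrite bin1 /= => E1 E2.
  by rewrite -mulnA -E1 mulnCA mulnA E2; ring.
have [ltNr|lerN] := ltnP N r; first by rewrite bin_small.
rewrite -mulnS -(addn2 n) expnD dvdn_mul //.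
  exact: dvdn_bin_odd.
rewrite -(@dvdn_addl (r * r).-1 (2 ^ 2)); last first.
  rewrite -(odd_double_half r) oddr; set h := r./2.
  by apply/dvdnP; exists (h * h.+1); rewrite -muln2; lia.
apply: (@dvdn_trans (r * N)); first exact: dvdn_mull.
rewrite (_ : _ + _ = r * N) //.
have rr : 0 < r * r by rewrite muln_gt0 r0.
by rewrite addSnnS prednK // -mulnDr subnK.
Qed.

Lemma dvdn_oddterm2 : 2 ^ n.+2 %| oddterm N r 2.
Proof.
apply: dvdn_oddterm => // -[|[|[|[|[|q]]]]] //= _ ler.
  by rewrite mulnA dvdn_mulr // (@dvdn_exp_binD 2 n N 3 0).
(* For q = 4, the factor 2^2 only pays for v(4); the missing 4 divides C(N-4, r-2), as r - 2 is odd
   and 4 divides N - 4. *)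
rewrite mulnA -(addn2 n) expnD dvdn_mul //.
  exact: (@dvdn_exp_bin n N 4 2).
by apply: dvdn_bin_odd; [apply: dvdn_sub | lia].
Qed.

Lemma dvdn_oddterm3 : 2 ^ n.+1 %| oddterm N r 3.
Proof.
apply: dvdn_oddterm => // q /andP[ltdq leqd] ler.
rewrite mulnA dvdn_mulr // (@dvdn_exp_binD 1 n N q 2) //; first lia.
by apply: logn2_lt; lia.
Qed.

(** Only q = 4 lacks a factor 2. It comes from C(N-4, r-1), as r - 1 is 2 modulo 4 and 4 divides N -
    4. *)
Lemma dvdn_oddterm3_3mod4 : r %% 4 = 3 -> 2 ^ n.+2 %| oddterm N r 3.
Proof.
move=> r3; apply: dvdn_oddterm => // -[|[|[|[|[|[|[|q]]]]]]] //= _ ler.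
- rewrite mulnA (expnSr 2 n.+1) dvdn_mul //.
    exact: (@dvdn_exp_binD 1 n N 4 2).
  rewrite -(@dvdn_pmul2l (2 ^ 1)) // (@dvdn_exp_bin 2) ?dvdn_sub //; first lia.
  by rewrite -ltnS ltnNge -pfactor_dvdn //; lia.
- by rewrite mulnA dvdn_mulr // (@dvdn_exp_binD 2 n N 5 1).
- by rewrite mulnA dvdn_mulr // (@dvdn_exp_binD 2 n N 6 1).
Qed.

Lemma dvdn_oddterm4 : 2 ^ n.+2 %| oddterm N r 4.
Proof.
have cut q : logn 2 q <= 2 -> 0 < q ->
    2 ^ n.+2 %| 2 ^ 4 * ('C(N, q) * 'C(N - q, r + 4 - q)).
  by move=> lq q0; rewrite mulnA dvdn_mulr // (@dvdn_exp_binD 2 n N q 2).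
apply: dvdn_oddterm => // -[|[|[|[|[|[|[|[|[|q]]]]]]]]] //= _ ler.
1-3: by apply: cut.
(* For q = 8, v(8) = 3 leaves only 2^(n+1); C(N-8, r-4) is even because r - 4 is odd. *)
rewrite mulnA (expnSr 2 n.+1) dvdn_mul //.
  exact: (@dvdn_exp_binD 1 n N 8 3).
by apply: (@dvdn_bin_odd 1); lia.
Qed.

End OddIndex.

Lemma oddcoef_mod n N r : 2 ^ n %| N -> exists x, oddcoef N r = 'C(N, r) + 2 ^ n * x.
Proof.
move=> dvdN; rewrite /oddcoef big_nat_recl // {1}/oddterm addn0 stirlnn !muln1.
suff /dvdnP[x ->] : 2 ^ n %| \sum_(0 <= d < N) oddterm N r d.+1.
  by exists x; rewrite (mulnC x).
apply: (big_ind (fun x => 2 ^ n %| x)) => // [x y|d _]; first exact: dvdn_add.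
exact: dvdn_oddterm_gen.
Qed.

Lemma oddcoef_split n N r : 2 <= n -> 0 < N -> 2 ^ n %| N ->
  exists x, oddcoef N r = (oddterm N r 0 + oddterm N r 1) + oddterm N r 2
    + oddterm N r 3 + oddterm N r 4 + 2 ^ n.+2 * x.
Proof.
move=> n2 N0 dvdN.
have N4 : 4 <= N.
  by apply: (leq_trans _ (dvdn_leq N0 dvdN)); rewrite (leq_exp2l 2 _ (isT : 1 < 2)).
have /dvdnP[x xE] : 2 ^ n.+2 %| \sum_(5 <= d < N.+1) oddterm N r d.
  rewrite big_nat; apply: (big_ind (fun x => 2 ^ n.+2 %| x)) => // [x y|d /andP[d5 _]].
    exact: dvdn_add.
  exact: dvdn_oddterm_ge5.
exists x; rewrite (mulnC _ x) -xE /oddcoef.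
rewrite (big_cat_nat (n := 5)) //=; congr (_ + _).
by rewrite /index_iota /= unlock /= addn0 !addnA.
Qed.

Lemma dvdn_oddcoef_odd n N r : 2 <= n -> 0 < N -> 2 ^ n %| N -> odd r ->
  2 ^ n.+1 %| oddcoef N r.
Proof.
move=> n2 N0 dvdN oddr; have [x ->] := oddcoef_split _ _ r n2 N0 dvdN.
have W y : 2 ^ n.+2 %| y -> 2 ^ n.+1 %| y by apply: dvdn_trans; apply: dvdn_exp2l.
apply: dvdn_add; last by apply: W; exact: dvdn_mulr.
apply: dvdn_add; last by apply: W; exact: dvdn_oddterm4.
apply: dvdn_add; last exact: dvdn_oddterm3.
apply: dvdn_add; last by apply: W; exact: dvdn_oddterm2.
by apply: W; exact: dvdn_oddterm01.
Qed.

Lemma dvdn_oddcoef_3mod4 n N r : 2 <= n -> 0 < N -> 2 ^ n %| N -> r %% 4 = 3 ->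
  2 ^ n.+2 %| oddcoef N r.
Proof.
move=> n2 N0 dvdN r3; have oddr : odd r by lia.
have [x ->] := oddcoef_split _ _ r n2 N0 dvdN.
apply: dvdn_add; last exact: dvdn_mulr.
apply: dvdn_add; last exact: dvdn_oddterm4.
apply: dvdn_add; last exact: dvdn_oddterm3_3mod4.
apply: dvdn_add; last exact: dvdn_oddterm2.
exact: dvdn_oddterm01.
Qed.

(** * Valuations *)

Lemma logn_subl a N s : 2 ^ a %| N -> 0 < s < 2 ^ a -> s < N ->
  logn 2 (N - s) = logn 2 s.
Proof.
move=> dvdN /andP[s0 lts] ltsN; have Ns0 : 0 < N - s by rewrite subn_gt0.
apply/eqP; rewrite eqn_leq -!pfactor_dvdn //; apply/andP; split.
  have [lea|lta] := leqP (logn 2 (N - s)) a.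
    have dN := dvdn_trans (dvdn_exp2l 2 lea) dvdN.
    by rewrite -(dvdn_addr _ (pfactor_dvdnn 2 (N - s))) subnK // ltnW.
  have dNs : 2 ^ a %| N - s by rewrite pfactor_dvdn // ltnW.
  suff /(dvdn_leq s0) : 2 ^ a %| s by rewrite leqNgt lts.
  by rewrite -(dvdn_addr _ dNs) subnK // ltnW.
rewrite dvdn_sub ?pfactor_dvdnn //.
apply: dvdn_trans (dvdn_exp2l 2 _) dvdN.
by rewrite logn2_lt // (leq_trans lts) // leq_exp2l.
Qed.

Lemma logn2_odd n : odd n -> logn 2 n = 0.
Proof. by move=> oddn; rewrite logn_coprime // coprime2n. Qed.

(** By [oddmomentE] it suffices that v((K-s)^_s) = s - v(s+1), shown by induction on s. *)
Lemma logn_oddmoment p r (K := (2 ^ p).-1.*2) : r < 2 ^ p ->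
  0 < oddmoment (2 ^ p) r /\ logn 2 (oddmoment (2 ^ p) r) + logn 2 r.+1 = K.
Proof.
move=> ltr; have p0 : 0 < 2 ^ p by rewrite expn_gt0.
have g0 s : s < 2 ^ p -> 0 < (K - s) ^_ s by move=> lts; rewrite ffact_gt0 /K; lia.
have KE : K = 2 ^ p.+1 - 2 by rewrite expnS /K; lia.
have lg s : s < 2 ^ p -> logn 2 ((K - s) ^_ s) + logn 2 s.+1 = s.
  elim: s => [|s IH] lts; first by rewrite subn0 ffactn0 logn1.
  (* As K - s = 2^(p+1) - (s+2), K - 2s = 2 (2^p - (s+1)) and K - 2s - 1 is odd, this step adds 1 +
     v(s+1) - v(s+2). *)
  have E : (K - s) * (K - s.+1) ^_ s.+1 = (K - s) ^_ s * ((K - s - s) * (K - s - s.+1)).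
    by rewrite subnS -ffactnS !ffactnSr mulnA.
  have := IH (ltnW lts); move: E (g0 s (ltnW lts)) (g0 s.+1 lts).
  move: ((K - s) ^_ s) ((K - s.+1) ^_ s.+1) => x y /(congr1 (logn 2)) + x0 y0.
  rewrite !lognM ?muln_gt0 //; try by [rewrite /K; lia].
  have -> : logn 2 (K - s) = logn 2 s.+2.
    rewrite -(@logn_subl p.+1 (2 ^ p.+1)) //; [congr logn; lia | rewrite expnS; lia..].
  have -> : logn 2 (K - s - s) = (logn 2 s.+1).+1.
    have -> : K - s - s = 2 * (2 ^ p - s.+1) by rewrite /K; lia.
    by rewrite lognM ?subn_gt0 // (@logn_subl p (2 ^ p)).
  have -> : logn 2 (K - s - s.+1) = 0.
    by apply: logn2_odd; rewrite /K; lia.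
  lia.
have moE := oddmomentE (2 ^ p) r p0; rewrite -/K in moE.
have w0 : 0 < oddmoment (2 ^ p) r.
  have : 0 < 2 ^ r * oddmoment (2 ^ p) r by rewrite moE muln_gt0 expn_gt0 g0.
  by rewrite muln_gt0 => /andP[].
split=> //; have := congr1 (logn 2) moE.
rewrite !lognM ?expn_gt0 ?g0 // !lognX /= !muln1; have := lg r ltr; lia.
Qed.

(** v((2a)!) = a + v(a!) yields v((2^m)!) = 2^m - 1; removing the factor 2^m costs m. *)
Lemma logn_fact_pow m : logn 2 (2 ^ m - 1)`! + m.+1 = 2 ^ m.
Proof.
have dbl n : logn 2 (n.*2)`! = n + logn 2 n`!.
  elim: n => // n IH; rewrite doubleS !factS !lognM ?muln_gt0 ?fact_gt0 // IH.
  rewrite -doubleS -mul2n lognM // (logn2_odd n.*2.+1) /= ?odd_double //.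
  by rewrite /= (_ : logn 2 2 = 1) //; lia.
have pow a : (logn 2 (2 ^ a)`!).+1 = 2 ^ a.
  by elim: a => // a IH; rewrite expnS mul2n dbl -addnS IH addnn.
have := pow m; rewrite -[in X in logn 2 X](subnK (expn_gt0 2 m)) addn1 factS.
rewrite lognM ?fact_gt0 // -[(2 ^ m - 1).+1]addn1 subnK ?expn_gt0 //.
by rewrite lognX muln1; lia.
Qed.

(** Successive binomials have ratio (N - (s+1)) / (s+1), whose terms have equal valuation. *)
Lemma logn_bin_pred a N s : 0 < N -> 2 ^ a %| N -> s < 2 ^ a ->
  logn 2 'C(N.-1, s) = 0.
Proof.
move=> N0 dvdN; have leN := dvdn_leq N0 dvdN.
elim: s => [|s IH] lts; first by rewrite bin0 logn1.
have ltsN : s.+1 < N by apply: leq_trans lts leN.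
have := congr1 (logn 2) (mul_bin_left N.-1 s).
rewrite !lognM ?bin_gt0 //; try lia.
by rewrite (IH (ltnW lts)) -subn1 -subnDA add1n (logn_subl a) //; lia.
Qed.

(** With m = p + 1, K - p is v(k!). The pair b_r, w_r contributes at least n+2 and K-p for r = 3 mod
    4, n+1 and K-1 for r = 1 mod 4, n-(p-2) and K for even r. *)
Lemma dvdn_oddcoef_moment p n N r : 2 <= p < n -> 0 < N -> 2 ^ n %| N ->
  0 < r < 2 ^ p -> r <> 2 ^ p.-1 ->
  2 ^ (n.+2 + ((2 ^ p).-1.*2 - p)) %| oddcoef N r * oddmoment (2 ^ p) r.
Proof.
move=> /andP[p2 ltpn] N0 dvdN /andP[r0 ltr] neqr.
have n2 : 2 <= n by lia.
have [w0] := logn_oddmoment p r ltr; set K := _.-1.*2 => lw.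
have leKp : p <= K by have := ltn_expl p (isT : 1 < 2); rewrite /K; lia.
have prod_dvd a b : 2 ^ a %| oddcoef N r -> n.+2 + (K - p) <= a + b ->
    b <= logn 2 (oddmoment (2 ^ p) r) ->
    2 ^ (n.+2 + (K - p)) %| oddcoef N r * oddmoment (2 ^ p) r.
  move=> da leab leb; apply: dvdn_trans (dvdn_exp2l 2 leab) _.
  by rewrite expnD dvdn_mul // pfactor_dvdn.
have [oddr|evenr] := boolP (odd r).
  have [r3|r1] := eqVneq (r %% 4) 3.
    apply: (prod_dvd n.+2 (K - p)) => //; first exact: dvdn_oddcoef_3mod4.
    suff : logn 2 r.+1 <= p by lia.
    by apply: logn2_lt => //; rewrite expnS; lia.
  apply: (prod_dvd n.+1 K.-1); [exact: dvdn_oddcoef_odd | lia |].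
  suff : logn 2 r.+1 < 2 by lia.
  by rewrite ltnNge -pfactor_dvdn //; lia.
have lwK : logn 2 (oddmoment (2 ^ p) r) = K.
  by move: lw; rewrite (logn2_odd r.+1) //= addn0.
(* The only multiple of 2^(p-1) strictly between 0 and 2^p is the excluded 2^(p-1). *)
have lr : logn 2 r <= p - 2.
  rewrite leqNgt; apply/negP => ltp.
  have /dvdnP[q qE] : 2 ^ p.-1 %| r by rewrite pfactor_dvdn //; lia.
  have := ltr; rewrite -[p in X in X -> _](prednK (ltnW p2)) expnS qE ltn_pmul2r ?expn_gt0 //.
  by case: q qE => [|[|q]] // qE; [lia | case: neqr; rewrite qE mul1n].
have db : 2 ^ n %| 2 ^ (p - 2) * oddcoef N r.
  have [x ->] := oddcoef_mod n N r dvdN.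
  by rewrite mulnDr dvdn_add ?dvdn_exp_bin // mulnCA dvdn_mulr.
have /dvdnP[w wE] : 2 ^ K %| oddmoment (2 ^ p) r by rewrite pfactor_dvdn // lwK.
rewrite wE (_ : K = (p - 2) + (K - p).+2); last lia.
rewrite (_ : n.+2 + _ = n + (K - p).+2); last lia.
rewrite (expnD 2 n) (expnD 2 (p - 2)) (_ : _ * (w * _) = (2 ^ (p - 2) * oddcoef N r) * (2 ^ (K - p).+2 * w)); last by ring.
by rewrite dvdn_mul // dvdn_mulr.
Qed.

Lemma odd_part n x : 0 < x -> logn 2 x = n -> exists2 u, odd u & x = 2 ^ n * u.
Proof.
move=> x0 <-; have [u cu uE] := pfactor_coprime (isT : prime 2) x0.
by exists u; rewrite -?coprime2n // mulnC.
Qed.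

(** C(N-1, h-1) is odd, so v(C(N, h)) = n - (p-1) < n, which the error 2^n x of [oddcoef_mod] cannot
    change; w_h adds K. *)
Lemma oddcoef_moment_half p n c : 2 <= p < n -> odd c ->
  exists2 u, odd u & oddcoef (c * 2 ^ n) (2 ^ p.-1) * oddmoment (2 ^ p) (2 ^ p.-1)
    = 2 ^ (n.+1 + ((2 ^ p).-1.*2 - p)) * u.
Proof.
move=> /andP[p2 ltpn] oddc; set N := c * _; set h := 2 ^ p.-1; set K := _.-1.*2.
have N0 : 0 < N by rewrite muln_gt0 expn_gt0 /=; case: c oddc {N}.
have dvdN : 2 ^ n %| N by exact: dvdn_mull.
have h0 : 0 < h by rewrite expn_gt0.
have lth : h < 2 ^ p by rewrite ltn_exp2l //; lia.
have lth' : h < 2 ^ n by rewrite ltn_exp2l //; lia.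
have lehN : h <= N by apply: leq_trans (ltnW lth') (dvdn_leq N0 dvdN).
have leKp : p <= K by have := ltn_expl p (isT : 1 < 2); rewrite /K; lia.
have [w0 lw] := logn_oddmoment p h lth.
have oddh : odd h.+1 by rewrite /= oddX; lia.
have [w oddw ->] : exists2 w, odd w & oddmoment (2 ^ p) h = 2 ^ K * w.
  by apply: odd_part => //; move: lw; rewrite (logn2_odd _ oddh) addn0.
have [v oddv CE] : exists2 v, odd v & 'C(N, h) = 2 ^ (n - p.-1) * v.
  apply: odd_part; first by rewrite bin_gt0.
  have := congr1 (logn 2) (mul_bin_diag N h.-1); rewrite prednK //.
  rewrite !lognM ?expn_gt0 ?bin_gt0 //; try lia.
  rewrite (logn_bin_pred n) //; last lia.
  by rewrite (logn2_odd c) // /h !lognX /= !muln1; lia.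
have [x ->] := oddcoef_mod n N h dvdN.
rewrite CE (_ : 2 ^ n = 2 ^ (n - p.-1) * 2 ^ p.-1); last by rewrite -expnD subnK //; lia.
exists ((v + 2 ^ p.-1 * x) * w).
  by rewrite oddM oddD oddM oddX oddv oddw; lia.
rewrite (_ : n.+1 + (K - p) = (n - p.-1) + K); last lia.
by rewrite expnD; ring.
Qed.

(** The term r = 0 is 2^K, r = 2^(p-1) gives an odd multiple, and the other terms change u by an
    even number. *)
Lemma sum_odd_expn_val p n c : 2 <= p < n -> odd c ->
  exists2 u, odd u &
  \sum_(0 <= j < 2 ^ p) 'C((2 ^ p).*2.-1, j.*2.+1) * j.*2.+1 ^ (c * 2 ^ n)
  = 2 ^ (2 ^ p).-1.*2 + 2 ^ (n.+1 + ((2 ^ p).-1.*2 - p)) * u.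
Proof.
move=> pn oddc; have /andP[p2 ltpn] := pn; set N := c * _; set h := 2 ^ p.-1; set K := _.-1.*2.
have N0 : 0 < N by rewrite muln_gt0 expn_gt0 /=; case: c oddc {N}.
have dvdN : 2 ^ n %| N by exact: dvdn_mull.
have h0 : 0 < h by rewrite expn_gt0.
have lth : h < 2 ^ p by rewrite ltn_exp2l //; lia.
have leN : 2 ^ p <= N.
  by apply: leq_trans (dvdn_leq N0 dvdN); rewrite leq_exp2l // ltnW.
rewrite sum_odd_expn ?(leq_trans leN) //.
rewrite big_ltn ?expn_gt0 // (big_cat_nat (n := h)) //=; last exact: ltnW.
rewrite [X in _ + (_ + X)]big_ltn //.
have [u oddu ->] := oddcoef_moment_half p n c pn oddc.
have rest a b : 0 < a -> b <= 2 ^ p -> (b <= h) || (h < a) ->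
    2 ^ (n.+2 + (K - p)) %| \sum_(a <= r < b) oddcoef N r * oddmoment (2 ^ p) r.
  move=> a0 leb sep; rewrite big_nat.
  apply: (big_ind (fun x => _ %| x)) => // [x y|r /andP[lea ltb]]; first exact: dvdn_add.
  by apply: dvdn_oddcoef_moment; rewrite -/h //; lia.
have /dvdnP[x ->] : 2 ^ (n.+2 + (K - p)) %| \sum_(1 <= r < h) oddcoef N r * oddmoment (2 ^ p) r.
  by apply: rest; rewrite ?leqnn // ltnW.
have /dvdnP[y ->] : 2 ^ (n.+2 + (K - p)) %| \sum_(h.+1 <= r < 2 ^ p) oddcoef N r * oddmoment (2 ^ p) r.
  by apply: rest => //; rewrite ltnSn orbT.
have -> : oddcoef N 0 = 1.
  rewrite /oddcoef big_nat_recl // big1 => [|d _]; first by rewrite /oddterm bin0.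
  by rewrite /oddterm add0n muln0.
have -> : oddmoment (2 ^ p) 0 = 2 ^ K.
  have := oddmomentE (2 ^ p) 0; rewrite expn_gt0 => /(_ isT).
  by rewrite mul1n ffactn0 muln1.
exists (u + 2 * (x + y)); first by rewrite oddD oddu oddM.
by rewrite addSn (expnS 2 (n.+1 + _)); ring.
Qed.

(** Once 2^N is taken out, j^N is j modulo 2, and the sum of C(k, 2j) j is a difference of two
    instances of [sum_oddbin_bin]. *)
Lemma dvdn_sum_even p N : 2 <= p -> 0 < N ->
  2 ^ N.+1 %| \sum_(0 <= j < 2 ^ p) 'C((2 ^ p).*2.-1, j.*2) * j.*2 ^ N.
Proof.
move=> p2 N0.
have -> : \sum_(0 <= j < 2 ^ p) 'C((2 ^ p).*2.-1, j.*2) * j.*2 ^ N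
    = 2 ^ N * \sum_(0 <= j < 2 ^ p) 'C((2 ^ p).*2.-1, j.*2) * j ^ N.
  rewrite big_distrr /=; apply: eq_bigr => j _.
  by rewrite -(mul2n j) expnMn mulnCA.
rewrite expnSr dvdn_pmul2l ?expn_gt0 //.
have par : 2 %| \sum_(0 <= j < 2 ^ p) 'C((2 ^ p).*2.-1, j.*2) * j ^ N
    + \sum_(0 <= j < 2 ^ p) 'C((2 ^ p).*2.-1, j.*2) * 'C(j, 1).
  rewrite -big_split /=; apply: (big_ind (fun x => 2 %| x)) => // [x y|j _].
    exact: dvdn_add.
  rewrite -mulnDr dvdn_mull // dvdn2 oddD oddX bin1.
  by case: N N0 => //= N _; rewrite addbb.
rewrite -(dvdn_addl _ (_ : 2 %| \sum_(0 <= j < 2 ^ p) 'C((2 ^ p).*2.-1, j.*2) * 'C(j, 1))) //.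
(* This form exposes enough factors 2 in both closed forms to survive division by 4. *)
have [K KE] : exists K, 2 ^ p = K.*2.+4.
  case: (p) p2 => [|[|q]] // _; exists (2 ^ q - 1).*2.
  by have := expn_gt0 2 q; rewrite !expnS; lia.
have := @oddbin_double (2 ^ p) (2 ^ p).*2.-1 1.
have := @sum_oddbin_bin (2 ^ p) (2 ^ p).*2.-1 1; have := @sum_oddbin_bin (2 ^ p) (2 ^ p).*2.-2 1.
rewrite KE /= !bin1 => /(_ _) E1 /(_ _) E2 E3.
move: (E1 ltac:(lia)) (E2 ltac:(lia)) E3; rewrite !expnS.
set a := \sum_(0 <= j < _) _; set b := \sum_(0 <= j < _) _; set e := \sum_(0 <= j < _) _.
lia.
Qed.

(** * From the two expansions to the valuation of the difference *)

Lemma nu2_sub F t X S1 S2 e1 e2 u1 u2 : 0 < F -> odd u1 ->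
  F * S1 + 2 ^ t.+1 * e1 = X + 2 ^ t * u1 ->
  F * S2 + 2 ^ t.+1 * e2 = X + 2 ^ t.+1 * u2 ->
  nu2 (S2%:Z - S1%:Z)%R + logn 2 F = t.
Proof.
move=> F0 oddu E1 E2; rewrite /nu2.
have -> : `|(S2%:Z - S1%:Z)%R|%N = (S2 - S1) + (S1 - S2) by lia.
set D := S2 - S1 + (S1 - S2).
have [y oddy FDE] : exists2 y, odd y & F * D = 2 ^ t * y.
  (* X cancels and F (S2 - S1) = 2^t (a - b), with a even and b odd. *)
  pose a := (u2 + e1).*2; pose b := u1 + e2.*2.
  have E : F * S2 + 2 ^ t * b = F * S1 + 2 ^ t * a.
    by move: E1 E2; rewrite /a /b !expnS -!mul2n; lia.
  exists ((a - b) + (b - a)); last first.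
    rewrite /D !mulnDr !mulnBr; move: E {E1 E2}.
    by move: (F * S1) (F * S2) (2 ^ t * a) (2 ^ t * b); lia.
  have oddb : odd b by rewrite oddD oddu odd_double.
  have evena : odd a = false by rewrite odd_double.
  case: (leqP a b) => [leab|/ltnW leba].
    by have /eqP-> : a - b == 0; rewrite ?subn_eq0 // oddB // oddb evena.
  by have /eqP-> : b - a == 0; rewrite ?subn_eq0 // addn0 oddB // oddb evena.
have : 0 < F * D by rewrite FDE muln_gt0 expn_gt0 /=; case: y oddy {FDE}.
rewrite muln_gt0 => /andP[_ D0].
have := congr1 (logn 2) FDE; rewrite !lognM ?expn_gt0 //; last by case: y oddy {FDE}.
by rewrite (logn2_odd y) // lognX /= muln1 addn0 addnC.
Qed.

(** Squaring 1 + 2^(n+2) u gives 1 + 2^(n+3) (u + 2^(n+1) u^2), whose bracket stays odd. *)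
Lemma expn3_val n c : 0 < n -> odd c ->
  exists2 u, odd u & 3 ^ (c * 2 ^ n) = 1 + 2 ^ n.+2 * u.
Proof.
move=> + oddc; elim: n => // -[|n] IH _.
  have [y yE] : exists y, 81 ^ c./2 = 1 + 16 * y.
    elim: c./2 => [|h [y IHh]]; first by exists 0.
    by exists (5 + 81 * y); rewrite expnS IHh; ring.
  (* 3^(2c) = 9 (1 + 16y) = 1 + 8 (1 + 18y). *)
  exists (1 + 18 * y); first by rewrite oddD oddM.
  have -> : c * 2 ^ 1 = 2 + 4 * c./2.
    by rewrite expn1 -{1}(odd_double_half c) oddc; lia.
  by rewrite expnD expnM yE; ring.
have [u oddu uE] := IH isT.
exists (u + 2 ^ n.+2 * (u * u)); first by rewrite oddD oddM oddX oddu.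
by rewrite (expnSr 2 n.+1) mulnA expnM uE !expnS; ring.
Qed.

Lemma leq_exp2_add m n : m <= n -> 2 ^ m + (n - m) <= 2 ^ n.
Proof.
move=> lemn; rewrite -{2}(subnKC lemn) expnD.
have := ltn_expl (n - m) (isT : 1 < 2); have := expn_gt0 2 m; nia.
Qed.

Lemma nu2_stirl3 c n : odd c -> 2 <= n -> (n, c) <> (2, 1) ->
  nu2 ((stirl (c * 2 ^ n.+1) 3)%:Z - (stirl (c * 2 ^ n) 3)%:Z)%R = n + 1.
Proof.
move=> oddc n2 neq.
have main N : 0 < N -> 3`! * stirl N 3 + 3 * 2 ^ N = 3 + 3 ^ N.
  move=> N0; have := @fact_stirl_altsum 1 N 3 erefl.
  rewrite !big_nat_recl // !big_geq //= exp0n // exp1n.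
  by rewrite -[_ = _ :> nat]/(3`! * stirl N 3 + (1 * 0 + (3 * 2 ^ N + 0)) = 3 * 1 + (1 * 3 ^ N + 0)); lia.
(* This makes 2^N negligible; it fails only in the excluded case n = 2, c = 1. *)
have N3 : n.+3 <= c * 2 ^ n.
  have [c1|c1] := eqVneq c 1.
    have : 2 ^ 3 + (n - 3) <= 2 ^ n by apply: leq_exp2_add; case: n n2 neq => [|[|[|]]] //; rewrite c1.
    by rewrite c1; lia.
  have : 2 ^ 2 + (n - 2) <= 2 ^ n by apply: leq_exp2_add.
  have c3 : 3 <= c by case: c oddc c1 {neq} => [|[|[|]]].
  nia.
have c0 : 0 < c by case: c oddc {neq N3}.
have [u oddu uE] := @expn3_val n c (ltnW n2) oddc.
have [v _ vE] := @expn3_val n.+1 c isT oddc.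
have N'3 : n.+3 <= c * 2 ^ n.+1 by rewrite expnS; lia.
have E1 := main _ (leq_trans (isT : 0 < n.+3) N3).
have E2 := main _ (leq_trans (isT : 0 < n.+3) N'3).
have pow2 N : n.+3 <= N -> 2 ^ N = 2 ^ n.+3 * 2 ^ (N - n.+3).
  by move=> leN; rewrite -expnD subnKC.
rewrite uE (pow2 _ N3) in E1; rewrite vE (pow2 _ N'3) in E2.
(* 3 + 3^N = 4 + 2^(n+2) u, and v(3!) = 1 lowers n + 2 to n + 1. *)
have := @nu2_sub 3`! n.+2 4 (stirl (c * 2 ^ n) 3) (stirl (c * 2 ^ n.+1) 3)
  (3 * 2 ^ (c * 2 ^ n - n.+3)) (3 * 2 ^ (c * 2 ^ n.+1 - n.+3)) _ v isT oddu.
rewrite ![_ ^ n.+3 * (3 * _)]mulnCA E1 E2 !addnA => /(_ erefl erefl).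
by rewrite (_ : logn 2 3`! = 1) // !addn1 => -[].
Qed.

Lemma nu2_stirl_gt2 c m n : odd c -> 3 <= m <= n ->
  nu2 ((stirl (c * 2 ^ n.+1) (2 ^ m - 1))%:Z - (stirl (c * 2 ^ n) (2 ^ m - 1))%:Z)%R
  = n + 1.
Proof.
case: m => // p oddc /andP[p2 ltpn]; rewrite ltnS in p2.
have [u oddu uE] := @sum_odd_expn_val p n c (introT andP (conj p2 ltpn)) oddc.
have [v _ vE] := @sum_odd_expn_val p n.+1 c (introT andP (conj p2 (leqW ltpn))) oddc.
have c0 : 0 < c by case: (c) oddc.
set M := 2 ^ p in uE vE; set K := M.-1.*2 in uE vE.
have M4 : 4 <= M by rewrite (leq_exp2l 2 p (isT : 1 < 2)).
have kE : 2 ^ p.+1 - 1 = M.-1.*2.+1 by rewrite expnS -/M; lia.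
have kE' : M.*2.-1 = 2 ^ p.+1 - 1 by rewrite expnS -/M; lia.
have main N := @fact_stirl_altsum M.-1 N _ kE.
rewrite prednK in main; last lia.
rewrite kE' in uE vE.
have lf := logn_fact_pow p.+1.
have even N : 2 ^ n <= N -> exists e,
    \sum_(0 <= j < M) 'C(2 ^ p.+1 - 1, j.*2) * j.*2 ^ N = 2 ^ (n.+1 + (K - p)).+1 * e.
  move=> leN; have N0 : 0 < N by apply: leq_trans leN; rewrite expn_gt0.
  have /dvdnP[e] := dvdn_sum_even p N p2 N0; rewrite kE' => ->.
  (* Equality holds for N = 2^n with n = p + 1, so the factor 2 beyond 2^N is essential there. *)
  have leNt : (n.+1 + (K - p)).+1 <= N.+1.
    have := leq_exp2_add p.+1 n ltpn; rewrite expnS -/M /K; lia.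
  by exists (e * 2 ^ (N.+1 - (n.+1 + (K - p)).+1)); rewrite -{1}(subnK leNt) expnD; ring.
have [e1 e1E] := even (c * 2 ^ n) (leq_pmull _ c0).
have [e2 e2E] := even (c * 2 ^ n.+1) (leq_trans (leq_pexp2l (isT : 0 < 2) (leqnSn n)) (leq_pmull _ c0)).
have := @nu2_sub (2 ^ p.+1 - 1)`! (n.+1 + (K - p)) (2 ^ K)
  (stirl (c * 2 ^ n) (2 ^ p.+1 - 1)) (stirl (c * 2 ^ n.+1) (2 ^ p.+1 - 1)) e1 e2 u v (fact_gt0 _) oddu.
rewrite -e1E -e2E !main uE vE addSn => /(_ erefl erefl).
(* v(k!) = K - p reduces n + 1 + (K - p) to n + 1. *)
have := ltn_expl p (isT : 1 < 2); move: lf; rewrite expnS -/M /K; lia.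
Qed.

Lemma leq_pow2_pred m n c : 0 < c -> m <= n -> 2 ^ m - 1 <= c * 2 ^ n.
Proof.
move=> c0 lemn; apply: leq_trans (leq_subr _ _) _.
by apply: leq_trans (leq_pmull _ c0); rewrite leq_exp2l.
Qed.

Theorem theorem1p3 :
  (forall c m n : nat,
     1 <= c -> odd c -> 2 <= m -> m <= n ->
     ~ (n = 2 /\ m = 2 /\ c = 1) ->
     nu2 ((stirling2 (c * 2 ^ n.+1) (2 ^ m - 1))%:Z
          - (stirling2 (c * 2 ^ n) (2 ^ m - 1))%:Z)%R = n + 1)
  /\ nu2 ((stirling2 8 3)%:Z - (stirling2 4 3)%:Z)%R = 6.
Proof.
(* The exceptional value is computed by the recurrence: 966 - 6 = 64 * 15. *)
split=> [c m n c0 oddc m2 lemn excl|]; last by rewrite !stirling2E.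
rewrite !stirling2E ?leq_pow2_pred ?leqW //.
have [m3|] := ltnP 2 m; first by apply: nu2_stirl_gt2; rewrite ?m3.
move=> lem2; have mE : m = 2 by apply/eqP; rewrite eqn_leq lem2.
rewrite mE in lemn excl *.
by apply: nu2_stirl3 => // -[n2 c1]; apply: excl.
Qed.
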